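(* Let $\{H_k:k<\omega\}$ be a class of finite graphs such that each $H_k$ is $d(k)$-regular, where both $d(k)\to\infty$ and $\operatorname{girth}(H_k)\to\infty$ as $k\to\infty$. Let $\mathcal{U}$ be a non-principal ultrafilter on $\omega$, $\mathcal{M}=\prod_{\mathcal{U}}H_k$, $\alpha=[\,|H_k|\,]_{\mathcal{U}}$ and $\beta=[d(k)]_{\mathcal{U}}$. If $E=\varphi(\mathcal{M},\bar a)\subseteq\mathcal{M}^1$ is a set definable (with parameters $\bar a$ from $\mathcal{M}$) by a first-order formula $\varphi(x,\bar y)$ in the language of graphs, then there exists a polynomial $p_E(t_1,t_2)\in\mathbb{Z}[t_1,t_2]$ such that $|E|=p_E(\alpha,\beta)$.
   Context: Graphs are simple; $\operatorname{girth}(H)$ is the length of a shortest cycle in $H$ (cycles have length $\geq 3$). For a definable set $X=\varphi(\mathcal{M}^n,\bar a)$ with $\bar a=[\bar a_k]_{\mathcal{U}}$, its non-standard cardinality is $|X|=[\,|\varphi(H_k^n,\bar a_k)|\,]_{\mathcal{U}}\in\mathbb{R}^{\mathcal{U}}$ (well defined by Łoś's theorem); polynomials are evaluated in the ordered ring $\mathbb{R}^{\mathcal{U}}$. *)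

(* Defs.v *)
From mathcomp Require Import all_boot all_order all_algebra.
From mathcomp Require Import mpoly.
Set Implicit Arguments.
Unset Strict Implicit.
Unset Printing Implicit Defensive.

Definition ultrafilter (U : (nat -> Prop) -> Prop) : Prop :=
  [/\ U (fun _ => True),
      ~ U (fun _ => False),
      (forall A B : nat -> Prop, U A -> (forall n, A n -> B n) -> U B),
      (forall A B : nat -> Prop, U A -> U B -> U (fun n => A n /\ B n))
    & (forall A : nat -> Prop, U A \/ U (fun n => ~ A n))].

Definition nonprincipal (U : (nat -> Prop) -> Prop) : Prop :=
  forall n : nat, ~ U (fun k => k = n).

Definition simple_graph (T : finType) (e : rel T) : Prop :=
  ssrbool.symmetric e /\ ssrbool.irreflexive e.

Definition neighbours (T : finType) (e : rel T) (v : T) : {set T} :=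
  [set w | e v w].

Definition regular (T : finType) (e : rel T) (d : nat) : Prop :=
  forall v : T, #|neighbours e v| = d.

Definition is_graph_cycle (T : finType) (e : rel T) (s : seq T) : Prop :=
  [/\ 3 <= size s, uniq s & cycle e s].

(* girth(H) > N : every cycle has length > N (true for forests, girth = oo) *)
Definition girth_gt (T : finType) (e : rel T) (N : nat) : Prop :=
  forall s : seq T, is_graph_cycle e s -> N < size s.

Inductive formula : Type :=
| FTrue : formula
| FFalse : formula
| FEq : nat -> nat -> formula
| FAdj : nat -> nat -> formula
| FNot : formula -> formula
| FAnd : formula -> formula -> formula
| FOr : formula -> formula -> formula
| FImp : formula -> formula -> formula
| FEx : nat -> formula -> formula
| FAll : nat -> formula -> formula.

Definition upd (T : Type) (rho : nat -> T) (i : nat) (v : T) : nat -> T :=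
  fun j => if j == i then v else rho j.

Fixpoint sat (T : finType) (e : rel T) (rho : nat -> T) (f : formula) : bool :=
  match f with
  | FTrue => true
  | FFalse => false
  | FEq i j => rho i == rho j
  | FAdj i j => e (rho i) (rho j)
  | FNot g => ~~ sat e rho g
  | FAnd g h => sat e rho g && sat e rho h
  | FOr g h => sat e rho g || sat e rho h
  | FImp g h => sat e rho g ==> sat e rho h
  | FEx i g => [exists v : T, sat e (upd rho i v) g]
  | FAll i g => [forall v : T, sat e (upd rho i v) g]
  end.

Fixpoint free (x : nat) (f : formula) : bool :=
  match f with
  | FTrue | FFalse => false
  | FEq i j | FAdj i j => (x == i) || (x == j)
  | FNot g => free x g
  | FAnd g h | FOr g h | FImp g h => free x g || free x h
  | FEx i g | FAll i g => (x != i) && free x g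
  end.

(* phi(x, y_1..y_m): variable 0 is x, variable j.+1 is y_(j+1) *)
Definition fv_below (n : nat) (f : formula) : Prop :=
  forall x, free x f -> x < n.

Definition env (T : finType) (m : nat) (a : 'I_m -> T) (x : T) : nat -> T :=
  fun i => match i with
           | 0 => x
           | j.+1 => match insub j with Some o => a o | None => x end
           end.

(* the k-th coordinate of the definable set phi(M, a): phi(H_k, a_k) *)
Definition defset (T : finType) (e : rel T) (m : nat) (phi : formula)
  (a : 'I_m -> T) : {set T} :=
  [set x : T | sat e (env a x) phi].

Definition eval2 (p : {mpoly int[2]}) (u v : int) : int :=
  p.@[fun i : 'I_2 => if val i == 0 then u else v].

(* Main.v *)
Require Import Defs.
From mathcomp Require Import all_boot all_order all_algebra.
From mathcomp Require Import mpoly zify.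

Set Implicit Arguments.
Unset Strict Implicit.
Unset Printing Implicit Defensive.

(* Girth beyond 2r+2 makes balls of radius r trees. Call a function of a tuple
   of vertices local if it is a finite decision tree on the relations
   d(x_i, x_j) <= r whose leaves are, for almost every k, polynomial in |H_k|
   and d(k). Local functions are closed under ring operations and under tests
   against constants, since the ultrafilter decides which value the test takes
   on each leaf. They are also closed under summation over one vertex: a vertex v
   at distance r+1 from x has a unique neighbour w of x on its geodesic, so sums
   over spheres reduce by induction on the radius to sums over the neighbours of
   a vertex; among these only the ones pointing towards another x_j are special,
   and their distances to the tuple are determined by those of the tuple.
   Negated distance conditions are removed by inclusion-exclusion, down to the
   unconstrained counts |H_k| and d(k). Hence the truth value of every formula is
   local (quantifiers are tests on sums), and so is the number of its solutions. *)

(** * Distances in graphs of large girth *)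

Section Distance.
Variables (T : finType) (e : rel T).
Hypotheses (e_sym : ssrbool.symmetric e) (e_irr : ssrbool.irreflexive e).
Implicit Types (r c a : nat) (u v w x y z : T).

(** Balls are boolean relations, so vertices in different components need no infinite distance. *)
Fixpoint within r x y : bool :=
  if r is r'.+1 then within r' x y || [exists w, e x w && within r' w y]
  else x == y.

Definition at_dist c x y : bool :=
  within c x y && (if c is c'.+1 then ~~ within c' x y else true).

Lemma within_refl r x : within r x x.
Proof. by elim: r => [|r IH] /=; rewrite ?eqxx ?IH. Qed.

Lemma withinS r x y : within r x y -> within r.+1 x y.
Proof. by move=> /= ->. Qed.

Lemma within_mono r s x y : r <= s -> within r x y -> within s x y.
Proof.
by move=> /subnK <- xy; elim: (s - r) => [//|n IH]; rewrite addSn; apply: withinS.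
Qed.

Lemma within_step r x w y : e x w -> within r w y -> within r.+1 x y.
Proof. by move=> xw wy; apply/orP; right; apply/existsP; exists w; rewrite xw. Qed.

Lemma within_trans r s x y z :
  within r x y -> within s y z -> within (r + s) x z.
Proof.
elim: r x => [|r IH] x /= => [/eqP -> //|/orP[xy yz|/existsP[w /andP[xw wy]] yz]].
  by apply/withinS/IH.
by rewrite -[_ || _]/(within (r + s).+1 x z); apply: (within_step xw); apply: IH.
Qed.

Lemma within_sym r x y : within r x y = within r y x.
Proof.
suff H u v : within r u v -> within r v u by apply/idP/idP; apply: H.
elim: r u v => [|r IH] u v /=; first by rewrite eq_sym.
move=> /orP[/IH-> //|/existsP[w /andP[uw /IH vw]]].
rewrite -[_ || _]/(within r.+1 v u) -addn1; apply: within_trans vw _.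
by rewrite e_sym in uw; apply: within_step uw (within_refl 0 u).
Qed.

Lemma at_dist_within c x y : at_dist c x y -> forall r, within r x y = (c <= r).
Proof.
case/andP=> cxy min r; case: leqP => [cr|]; first exact: within_mono cxy.
by case: c cxy min => // c _ xy rc; apply: contraNF xy; apply: within_mono.
Qed.

Lemma within_at_dist r x y : within r x y -> exists2 c, c <= r & at_dist c x y.
Proof.
elim: r => [|r IH] xy; first by exists 0; rewrite // /at_dist xy.
case xy': (within r x y); first by have [c cr] := IH xy'; exists c; rewrite // ltnW.
by exists r.+1; rewrite // /at_dist xy xy'.
Qed.

Lemma at_dist_inj a c x y : at_dist a x y -> at_dist c x y -> a = c.
Proof.
move=> xya xyc; apply/eqP.
have ha := at_dist_within xya; have hc := at_dist_within xyc.
rewrite eqn_leq; move: (ha a) (hc a) (ha c) (hc c).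
by rewrite !leqnn => -> <- <- ->.
Qed.

Lemma at_dist_adj c x w y : at_dist c x y -> e x w ->
  exists c', [/\ at_dist c' w y, c' <= c.+1 & c <= c'.+1].
Proof.
move=> xy xw; have wx : e w x by rewrite e_sym.
have /within_at_dist[c' c'c wy] : within c.+1 w y.
  by apply: within_step wx _; rewrite (at_dist_within xy).
exists c'; split=> //; rewrite -(at_dist_within xy).
by apply: within_step xw _; rewrite (at_dist_within wy).
Qed.

Lemma at_dist_pred c x y : at_dist c.+1 x y -> exists2 w, e x w & at_dist c w y.
Proof.
move=> xy; have := xy; rewrite /at_dist /= => /andP[].
case: (within c x y) => //= /existsP[w /andP[xw wy]] _; exists w => //.
have [c' [wy' c'c cc']] := at_dist_adj xy xw.
suff -> : c = c' by [].
by move: wy; rewrite (at_dist_within wy'); lia.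
Qed.

(** Follow geodesics from [u] and [w] towards [y] until they meet. The inner path stays in the ball
    of radius [c] around [y], so endpoints at distance [c.+1] are new vertices. *)
Lemma geodesics_merge c u w y : at_dist c u y -> at_dist c w y -> u != w ->
  exists s, [/\ path e u s, last u s = w, uniq (u :: s),
                1 < size s <= c.*2 & all (fun z => within c z y) (u :: s)].
Proof.
elim: c u w => [|c IH] u w uy wy.
  by move: uy wy; rewrite /at_dist /= !andbT => /eqP-> /eqP->; rewrite eqxx.
have [u' uu' u'y] := at_dist_pred uy; have [w' ww' w'y] := at_dist_pred wy.
rewrite e_sym in ww' => uw.
have far z : at_dist c.+1 z y -> within c z y = false.
  by move=> zy; rewrite (at_dist_within zy) ltnn.
case: (eqVneq u' w') => [eqw|/IH].
  subst w'; exists [:: u'; w]; split=> //=.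
  - by rewrite uu' ww'.
  - rewrite !inE negb_or uw !andbT; apply/andP; split.
      by apply: contraFneq (far _ uy) => ->; rewrite (at_dist_within u'y).
    by apply: contraFneq (far _ wy) => <-; rewrite (at_dist_within u'y).
  - rewrite -![_ || _]/(within c.+1 _ y).
    by rewrite (at_dist_within uy) (at_dist_within wy) (at_dist_within u'y) leqnn leqnSn.
move=> /(_ u'y w'y)[s [ps ls us ss as_]].
have notin z : at_dist c.+1 z y -> z \notin u' :: s.
  by move=> zy; apply: contraFN (far _ zy) => /(allP as_).
exists (rcons (u' :: s) w); split.
- by rewrite rcons_path /= uu' ps ls.
- by rewrite last_rcons.
- by rewrite -rcons_cons rcons_uniq inE negb_or eq_sym uw notin //= notin.
- rewrite size_rcons /= doubleS; move: ss; lia.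
- apply/allP=> z; rewrite inE mem_rcons inE.
  case/or3P=> [/eqP->|/eqP->|/(allP as_)]; last exact: withinS.
    by rewrite (at_dist_within uy).
  by rewrite (at_dist_within wy).
Qed.

Variable N : nat.
Hypothesis girth_N : girth_gt e N.

(** Otherwise the edge closes the merged geodesics into a cycle of length at most [c.*2.+1]. *)
Lemma adj_at_dist_neq c u w y : c.*2 < N ->
  e u w -> at_dist c u y -> ~~ at_dist c w y.
Proof.
move=> cN uw uy; apply/negP=> wy.
have u_w : u != w by apply: contraFneq (e_irr u) => {2}->.
have [s [ps ls us /andP[s1 s2] _]] := geodesics_merge uy wy u_w.
have /girth_N : is_graph_cycle e (u :: s).
  by split=> //=; rewrite rcons_path ps ls e_sym.
rewrite /=; lia.
Qed.

(** Two such neighbours would close up through [x], which lies outside the ball containing the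
    merged geodesics, into a cycle of length at most [c.*2.+2]. *)
Lemma pred_unique c x u w y : c.*2.+1 < N -> e x u -> e x w ->
  at_dist c.+1 x y -> at_dist c u y -> at_dist c w y -> u = w.
Proof.
move=> cN xu xw xy uy wy; apply/eqP/negPn/negP=> uw.
have [s [ps ls us /andP[s1 s2] as_]] := geodesics_merge uy wy uw.
have /girth_N : is_graph_cycle e (x :: u :: s).
  split; [by rewrite /=; lia| |by rewrite /= rcons_path xu ps ls e_sym].
  rewrite cons_uniq us andbT; apply/negP=> /(allP as_).
  by rewrite (at_dist_within xy) ltnn.
rewrite /=; lia.
Qed.

Lemma at_dist_adj_cases c x w y : c.*2 < N -> at_dist c x y -> e x w ->
  at_dist c.+1 w y \/ exists2 c', c = c'.+1 & at_dist c' w y.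
Proof.
move=> cN xy xw; have [c' [wy h1 h2]] := at_dist_adj xy xw.
have : c' <> c by move=> E; subst c'; move: (adj_at_dist_neq cN xw xy); rewrite wy.
move=> ne; have [E|E] : c' = c.+1 \/ c = c'.+1 by lia.
  by left; rewrite -E.
by right; exists c'.
Qed.

(** A walk without backtracking is a geodesic: once a step leads away from [y], the next step
    towards [z] does too, since the only neighbour of [w] closer to [y] is [x]. *)
Lemma at_dist_branch a c x w y z : (a + c).*2.+3 < N -> e x w ->
  at_dist a w z -> at_dist a.+1 x z -> at_dist c x y -> at_dist c.+1 w y ->
  at_dist (a.+1 + c) z y.
Proof.
elim: a c x w => [|a IH] c x w aN xw wz xz xy wy.
  by move: wz; rewrite /at_dist /= andbT => /eqP <-.
have [w2 ww2 w2z] := at_dist_pred wz.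
have w2y : at_dist c.+2 w2 y.
  case: (at_dist_adj_cases _ wy ww2) => [|//|[c' [E] w2y]]; first by lia.
  subst c'; have wx : e w x by rewrite e_sym.
  have E : w2 = x by apply: (pred_unique _ ww2 wx wy) => //; lia.
  by move: w2z; rewrite E => /at_dist_inj/(_ xz); lia.
by rewrite addSnnS; apply: IH ww2 _ _ _ _ => //; lia.
Qed.

(* In a tree the distance to y' from the point w on the geodesic from x to y
   is the larger of d(x, y') - d(x, w) and d(y, y') - d(w, y). *)
Lemma within_geodesic r c x w y y' : (r + c).*2 + 5 < N -> e x w ->
  at_dist c w y -> at_dist c.+1 x y ->
  within r w y' = within r.+1 x y' && within (r + c) y y'.
Proof.
move=> rN xw wy xy; apply/idP/andP => [wy'|[xy' yy']].
  split; first exact: within_step xw wy'.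
  rewrite addnC; apply: within_trans wy'.
  by rewrite within_sym (at_dist_within wy).
have [c' c'r xy'c] := within_at_dist xy'.
have [|wy'|[c'' E wy']] := at_dist_adj_cases _ xy'c xw; first by lia.
  (* Here [y'] branches off at [x] or behind it, so the geodesic from [y] to [y'] passes through
     [x]. *)
  have yy'c : at_dist (c.+1 + c') y y'.
    by apply: at_dist_branch xw wy xy xy'c wy'; lia.
  by move: yy'; rewrite (at_dist_within yy'c) (at_dist_within wy'); lia.
by rewrite (at_dist_within wy'); lia.
Qed.

Lemma within_adj_near r x w y : e x w -> within r x y -> within r.+1 w y.
Proof. by rewrite e_sym; apply: within_step. Qed.

Lemma within_adj_far r x w y : e x w -> ~~ within r.+1 x y -> within r w y = false.
Proof. by move=> xw; apply: contraNF; apply: within_step. Qed.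

(** By parity [w] is at distance [c] or [c.+2] from [y], and both admissible radii separate
    these. *)
Lemma within_adj_exact r c x w y : c.*2 + 2 < N -> c <= r <= c.+1 ->
  e x w -> at_dist c.+1 x y -> within r w y = at_dist c w y.
Proof.
move=> cN cr xw xy; apply/idP/idP=> [wy|wy]; last by rewrite (at_dist_within wy); lia.
have [|wy'|[c' [->] //]] := at_dist_adj_cases _ xy xw; first by lia.
by move: wy; rewrite (at_dist_within wy'); lia.
Qed.

End Distance.

(** * Local functions along an ultrafilter *)

Lemma sat_eq_free (T : finType) (e : rel T) (f : formula) (rho rho' : nat -> T) :
  (forall x, Defs.free x f -> rho x = rho' x) -> sat e rho f = sat e rho' f.
Proof.
elim: f rho rho' => //=.
- by move=> i j rho rho' E; rewrite !E ?eqxx ?orbT.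
- by move=> i j rho rho' E; rewrite !E ?eqxx ?orbT.
- by move=> f IH rho rho' E; rewrite (IH rho rho').
- by move=> f IHf g IHg rho rho' E; rewrite (IHf rho rho') 1?(IHg rho rho') //;
    move=> x fx; apply: E; rewrite fx ?orbT.
- by move=> f IHf g IHg rho rho' E; rewrite (IHf rho rho') 1?(IHg rho rho') //;
    move=> x fx; apply: E; rewrite fx ?orbT.
- by move=> f IHf g IHg rho rho' E; rewrite (IHf rho rho') 1?(IHg rho rho') //;
    move=> x fx; apply: E; rewrite fx ?orbT.
- move=> i f IH rho rho' E; apply: eq_existsb => v; apply: IH => x fx.
  by rewrite /upd; case: eqVneq => // xi; apply: E; rewrite xi.
- move=> i f IH rho rho' E; apply: eq_forallb => v; apply: IH => x fx.
  by rewrite /upd; case: eqVneq => // xi; apply: E; rewrite xi.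
Qed.

Lemma seq_le_bound (A : eqType) (f : A -> nat) (s : seq A) :
  exists M, forall a, a \in s -> f a <= M.
Proof. by exists (\max_(a <- s) f a) => a sa; apply: leq_bigmax_seq. Qed.

Section LocalFunctions.
Import GRing.Theory.
Local Open Scope ring_scope.

Variables (T : nat -> finType) (e : forall k, rel (T k)) (d : nat -> nat).
Arguments e : clear implicits.
Variable U : (nat -> Prop) -> Prop.
Hypothesis e_simple : forall k, simple_graph (e k).
Hypothesis e_reg : forall k, regular (e k) (d k).
Hypothesis U_ultra : ultrafilter U.
Hypothesis U_girth : forall N, U (fun k => girth_gt (e k) N).

Let e_sym k : ssrbool.symmetric (e k). Proof. by case: (e_simple k). Qed.
Let e_irr k : ssrbool.irreflexive (e k). Proof. by case: (e_simple k). Qed.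

Lemma ultra_all (A : nat -> Prop) : (forall k, A k) -> U A.
Proof. by case: U_ultra => UT _ Umono _ _ hA; apply: Umono UT _. Qed.

Lemma ultra_mono (A B : nat -> Prop) : U A -> (forall k, A k -> B k) -> U B.
Proof. by case: U_ultra => _ _ Umono _ _; apply: Umono. Qed.

Lemma ultra_mono2 (A B C : nat -> Prop) :
  U A -> U B -> (forall k, A k -> B k -> C k) -> U C.
Proof.
case: U_ultra => _ _ Umono Uand _ UA UB h.
by apply: Umono (Uand _ _ UA UB) _ => k []; apply: h.
Qed.

Lemma ultra_dec (A : nat -> Prop) : U A \/ U (fun k => ~ A k).
Proof. by case: U_ultra. Qed.

(** * Sequences that are polynomial almost everywhere *)

Definition poly_ae (g : nat -> int) : Prop :=
  exists p, U (fun k => g k = eval2 p #|T k|%:Z (d k)%:Z).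

Lemma poly_ae_eq g g' : poly_ae g -> U (fun k => g' k = g k) -> poly_ae g'.
Proof.
by move=> [p Up] Ug; exists p; apply: ultra_mono2 Up Ug _ => k <- ->.
Qed.

Lemma poly_ae_const c : poly_ae (fun=> c).
Proof. by exists c%:MP; apply: ultra_all => k; rewrite /eval2 mevalC. Qed.

Lemma poly_ae_card : poly_ae (fun k => #|T k|%:Z).
Proof. by exists 'X_ord0; apply: ultra_all => k; rewrite /eval2 mevalXU. Qed.

Lemma poly_ae_deg : poly_ae (fun k => (d k)%:Z).
Proof. by exists 'X_ord_max; apply: ultra_all => k; rewrite /eval2 mevalXU. Qed.

Lemma poly_aeD g g' : poly_ae g -> poly_ae g' -> poly_ae (fun k => g k + g' k).
Proof.
move=> [p Up] [q Uq]; exists (p + q).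
by apply: ultra_mono2 Up Uq _ => k -> ->; rewrite /eval2 mevalD.
Qed.

Lemma poly_aeB g g' : poly_ae g -> poly_ae g' -> poly_ae (fun k => g k - g' k).
Proof.
move=> [p Up] [q Uq]; exists (p - q).
by apply: ultra_mono2 Up Uq _ => k -> ->; rewrite /eval2 mevalB.
Qed.

Lemma poly_aeM g g' : poly_ae g -> poly_ae g' -> poly_ae (fun k => g k * g' k).
Proof.
move=> [p Up] [q Uq]; exists (p * q).
by apply: ultra_mono2 Up Uq _ => k -> ->; rewrite /eval2 mevalM.
Qed.

(** The ultrafilter decides [b], so the sequence is almost everywhere the constant 0 or 1. *)
Lemma poly_ae_bool (b : nat -> bool) : poly_ae (fun k => (b k : nat)%:Z).
Proof.
case: (ultra_dec b) => [Ub|Ub].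
  by apply: (poly_ae_eq (poly_ae_const 1)); apply: ultra_mono Ub _ => k ->.
by apply: (poly_ae_eq (poly_ae_const 0)); apply: ultra_mono Ub _ => k /negP/negbTE ->.
Qed.

(* Decision trees on the truth of d(rho i, rho j) <= r, with leaves that do not
   depend on rho and are polynomial in |H_k| and d(k) for almost every k. *)
Inductive local : (forall k, (nat -> T k) -> int) -> Prop :=
| local_leaf g F : poly_ae g -> U (fun k => forall rho, F k rho = g k) -> local F
| local_node r i j F1 F2 F : local F1 -> local F2 ->
    U (fun k => forall rho,
         F k rho = if within (e k) r (rho i) (rho j) then F1 k rho else F2 k rho) ->
    local F.

Definition localb (B : forall k, (nat -> T k) -> bool) : Prop :=
  local (fun k rho => (B k rho : nat)%:Z).

Lemma local_eq F F' : local F -> U (fun k => forall rho, F' k rho = F k rho) -> local F'.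
Proof.
case=> [g {}F pg Ug|r i j F1 F2 {}F lF1 lF2 UF] UFF'.
  by apply: (local_leaf pg); apply: ultra_mono2 Ug UFF' _ => k h h' rho; rewrite h' h.
apply: (local_node (r := r) (i := i) (j := j) lF1 lF2).
by apply: ultra_mono2 UF UFF' _ => k h h' rho; rewrite h' h.
Qed.

Lemma local_ext F F' : local F -> (forall k rho, F' k rho = F k rho) -> local F'.
Proof. by move=> lF E; apply: local_eq lF _; apply: ultra_all. Qed.

Lemma local_const g : poly_ae g -> local (fun k _ => g k).
Proof. by move=> pg; apply: (local_leaf pg); apply: ultra_all. Qed.

(** Graft the tree of [F2] onto every leaf of the tree of [F1], and combine the leaves by [h]. *)
Lemma local_map2 (h : int -> int -> int) :
    (forall g1 g2, poly_ae g1 -> poly_ae g2 -> poly_ae (fun k => h (g1 k) (g2 k))) ->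
  forall F1 F2, local F1 -> local F2 -> local (fun k rho => h (F1 k rho) (F2 k rho)).
Proof.
move=> ph F1 F2 lF1; elim: lF1 F2 => {F1}
  [g1 F1 pg1 U1|r i j G1 G2 F1 _ IH1 _ IH2 U1] F2 lF2.
  elim: lF2 => {F2} [g2 F2 pg2 U2|r i j G1 G2 F2 _ IH1 _ IH2 U2].
    apply: (local_leaf (ph _ _ pg1 pg2)).
    by apply: ultra_mono2 U1 U2 _ => k h1 h2 rho; rewrite h1 h2.
  apply: (local_node (r := r) (i := i) (j := j) IH1 IH2).
  by apply: ultra_mono U2 _ => k h2 rho; rewrite h2; case: ifP.
apply: (local_node (r := r) (i := i) (j := j) (IH1 _ lF2) (IH2 _ lF2)).
by apply: ultra_mono U1 _ => k h1 rho; rewrite h1; case: ifP.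
Qed.

Lemma localD F1 F2 : local F1 -> local F2 -> local (fun k rho => F1 k rho + F2 k rho).
Proof. exact: (local_map2 (h := fun x y => x + y) poly_aeD). Qed.

Lemma localB F1 F2 : local F1 -> local F2 -> local (fun k rho => F1 k rho - F2 k rho).
Proof. exact: (local_map2 (h := fun x y => x - y) poly_aeB). Qed.

Lemma localM F1 F2 : local F1 -> local F2 -> local (fun k rho => F1 k rho * F2 k rho).
Proof. exact: (local_map2 (h := fun x y => x * y) poly_aeM). Qed.

Lemma localb_test (b : int -> bool) F : local F -> localb (fun k rho => b (F k rho)).
Proof.
move=> lF; apply: (local_map2 (h := fun x _ => (b x : nat)%:Z) _ lF lF).
by move=> g1 g2 _ _; apply: poly_ae_bool.
Qed.

Lemma localb_eq B B' : localb B -> (forall k rho, B' k rho = B k rho) -> localb B'.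
Proof. by move=> lB E; apply: local_ext lB _ => k rho; rewrite E. Qed.

Lemma localb_const b : localb (fun _ _ => b).
Proof. exact/local_const/poly_ae_const. Qed.

Lemma localbN B : localb B -> localb (fun k rho => ~~ B k rho).
Proof.
move=> lB; apply: localb_eq (localb_test (fun x => x == 0) lB) _ => k rho.
by case: (B k rho).
Qed.

Lemma localbI B1 B2 : localb B1 -> localb B2 -> localb (fun k rho => B1 k rho && B2 k rho).
Proof.
move=> l1 l2; apply: local_ext (localM l1 l2) _ => k rho.
by case: (B1 k rho); case: (B2 k rho).
Qed.

Lemma localb_eqb B b : localb B -> localb (fun k rho => B k rho == b).
Proof.
case: b => lB; first by apply: localb_eq lB _ => k rho; rewrite eqb_id.
by apply: localb_eq (localbN lB) _ => k rho; rewrite eqbF_neg.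
Qed.

Lemma localb_all (A : Type) (B : A -> forall k, (nat -> T k) -> bool) (s : seq A) :
  (forall a, localb (B a)) -> localb (fun k rho => all (fun a => B a k rho) s).
Proof.
move=> lB; elim: s => [|a s IH] /=; first exact: localb_const.
exact: localbI.
Qed.

Lemma localb_within r i j : localb (fun k rho => within (e k) r (rho i) (rho j)).
Proof.
apply: (local_node (r := r) (i := i) (j := j) (localb_const true) (localb_const false)).
by apply: ultra_all => k rho; case: ifP.
Qed.

Lemma local_if B F1 F2 : localb B -> local F1 -> local F2 ->
  local (fun k rho => if B k rho then F1 k rho else F2 k rho).
Proof.
move=> lB l1 l2; apply: local_ext (localD (localM lB l1) (localM (localbN lB) l2)) _.
by move=> k rho; case: (B k rho); rewrite /= ?mul1r ?mul0r ?addr0 ?add0r.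
Qed.

(* A literal (r, j, b) on a vertex v asserts that d(v, rho j) <= r has truth
   value b. *)
Definition literal k (rho : nat -> T k) (v : T k) (l : nat * nat * bool) : bool :=
  within (e k) l.1.1 v (rho l.1.2) == l.2.

(** The instances are [nbr x] and [everywhere]; the reduction of sums to counts is shared. *)
Definition vertex_range : Type := forall k, (nat -> T k) -> pred (T k).

Definition count_in (A : vertex_range) L k (rho : nat -> T k) : int :=
  \sum_(v | A k rho v && all (literal rho v) L) 1.

Lemma sum_split_bool (I : finType) (A B Q : pred I) (f : I -> int) :
  \sum_(v | A v && Q v) f v = \sum_(v | A v && ((B v == true) && Q v)) f v +
                              \sum_(v | A v && ((B v == false) && Q v)) f v.
Proof.
rewrite (bigID B) /=; congr (_ + _); apply: eq_bigl => v;
  by rewrite ?eqb_id ?eqbF_neg -!andbA; congr (_ && _); rewrite andbC.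
Qed.

(** Induction on the tree of [F]. A test of the bound vertex against another variable splits the
    range by a literal, a test between other variables stays a node, and a leaf is a constant times
    a count. Literals accumulate in [L]. *)
Lemma local_sum (A : vertex_range) i F : (forall L, local (@count_in A L)) -> local F ->
  forall L, local (fun k rho =>
    \sum_(v | A k rho v && all (literal rho v) L) F k (upd rho i v)).
Proof.
move=> lA; elim=> {F} [g F pg UF|r a b F1 F2 F _ IH1 _ IH2 UF] L.
  apply: local_eq (localM (local_const pg) (lA L)) _.
  apply: ultra_mono UF _ => k h rho; rewrite mulr_sumr.
  by apply: eq_bigr => v _; rewrite h mulr1.
have split_on c : (forall k (rho : nat -> T k) v,
    within (e k) r (upd rho i v a) (upd rho i v b) = within (e k) r v (rho c)) ->
  local (fun k rho =>
    \sum_(v | A k rho v && all (literal rho v) L) F k (upd rho i v)).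
  move=> E; apply: local_eq (localD (IH1 ((r, c, true) :: L)) (IH2 ((r, c, false) :: L))) _.
  apply: ultra_mono UF _ => k h rho.
  rewrite (sum_split_bool _ (fun v => within (e k) r v (rho c))).
  by congr (_ + _); apply: eq_bigr => v /and3P[_ /eqP w _]; rewrite h E w.
have [ai|ai] := eqVneq a i; have [bi|bi] := eqVneq b i.
- apply: local_eq (IH1 L) _; apply: ultra_mono UF _ => k h rho.
  by apply: eq_bigr => v _; rewrite h /upd ai bi eqxx within_refl.
- by apply: (split_on b) => k rho v; rewrite /upd ai eqxx (negbTE bi).
- by apply: (split_on a) => k rho v; rewrite /upd bi eqxx (negbTE ai) within_sym.
- apply: (local_node (r := r) (i := a) (j := b) (IH1 L) (IH2 L)).
  apply: ultra_mono UF _ => k h rho; rewrite -fun_if.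
  case: ifP => w; apply: eq_bigr => v _;
    by rewrite h /upd (negbTE ai) (negbTE bi) w.
Qed.

(* Inclusion-exclusion: a negative literal is traded for its absence minus the
   corresponding positive literal. *)
Lemma local_count_in (A : vertex_range) : local (@count_in A [::]) ->
    (forall r j L, local (@count_in A L) -> local (@count_in A ((r, j, true) :: L))) ->
  forall L, local (@count_in A L).
Proof.
move=> l0 lpos; elim=> [//|[[r j] []] L IH]; first exact: lpos.
apply: local_ext (localB IH (lpos r j L IH)) _ => k rho.
apply/eqP; rewrite eq_sym subr_eq addrC; apply/eqP.
exact: (sum_split_bool _ (fun v => within (e k) r v (rho j))).
Qed.

(** * Counting neighbours of a vertex *)

Definition nbr (x : nat) : vertex_range := fun k rho => e k (rho x).

(** By [within_geodesic], this is the truth of [L] at the neighbour of [x] towards [rho j],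
    expressed without naming that neighbour. *)
Definition geodesic_literals x j c (L : seq (nat * nat * bool)) k (rho : nat -> T k) :=
  all (fun l => (within (e k) l.1.1.+1 (rho x) (rho l.1.2) &&
                 within (e k) (l.1.1 + c) (rho j) (rho l.1.2)) == l.2) L.

Lemma localb_geodesic_literals x j c L : localb (@geodesic_literals x j c L).
Proof.
apply: (localb_all (B := fun l k rho => (within (e k) l.1.1.+1 (rho x) (rho l.1.2) &&
   within (e k) (l.1.1 + c) (rho j) (rho l.1.2)) == l.2)) => l.
by apply: localb_eqb; apply: localbI; apply: localb_within.
Qed.

(** Only the neighbour of [x] on the geodesic to [rho j] meets the first literal, so the count is 0
    or 1. *)
Lemma count_nbr_exact x j r c M (L : seq (nat * nat * bool)) N k (rho : nat -> T k) :
    (forall l, l \in L -> l.1.1 <= M)%N -> girth_gt (e k) N ->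
    ((M + c).*2 + 5 < N)%N -> (c <= r <= c.+1)%N ->
    at_dist (e k) c.+1 (rho x) (rho j) ->
  count_in (nbr x) ((r, j, true) :: L) rho = (geodesic_literals x j c L rho : nat)%:Z.
Proof.
move=> LM gN MN cr xj; have [w0 xw0 w0j] := at_dist_pred (@e_sym k) xj.
rewrite /count_in (eq_bigl (fun w => (w == w0) && geodesic_literals x j c L rho)).
  case: geodesic_literals; last by rewrite big_pred0 // => w; rewrite andbF.
  by rewrite (eq_bigl (pred1 w0)) ?big_pred1_eq // => w; rewrite andbT.
move=> w; rewrite /nbr /literal /= eqb_id.
have [->|w_w0] := eqVneq w w0.
  rewrite xw0 (@within_adj_exact _ _ (@e_sym k) (@e_irr k) N gN r c _ _ _ _ cr xw0 xj).
    rewrite w0j; apply: eq_in_all => -[[s i] b] /LM /= sM.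
    rewrite (@within_geodesic _ _ (@e_sym k) (@e_irr k) N gN _ c (rho x) w0 (rho j)) //.
    lia.
  lia.
apply/andP=> -[xw /andP[wj _]]; case/eqP: w_w0.
apply: (@pred_unique _ _ (@e_sym k) N gN c (rho x) _ _ (rho j)) => //; first by lia.
rewrite -(@within_adj_exact _ _ (@e_sym k) (@e_irr k) N gN r c (rho x)) //; lia.
Qed.

Lemma local_count_nbr x L : local (@count_in (nbr x) L).
Proof.
move: L; apply: local_count_in.
  apply: local_ext (local_const poly_ae_deg) _ => k rho.
  rewrite /count_in -(e_reg (rho x)) -sum1_card -natz natr_sum.
  by apply: eq_bigl => w; rewrite /nbr inE andbT.
move=> r j L lL; have [M LM] := seq_le_bound (fun l => l.1.1) L.
have lV c := localb_geodesic_literals x j c L.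
have lW s := localb_within s x j.
have l0 : local (fun _ _ => 0) by apply/local_const/poly_ae_const.
have Ufar : U (fun k => forall rho, ~~ within (e k) r.+1 (rho x) (rho j) ->
    count_in (nbr x) ((r, j, true) :: L) rho = 0).
  apply: ultra_all => k rho far; apply: big_pred0 => w; rewrite /nbr /literal /=.
  by apply/andP=> -[xw]; rewrite (within_adj_far xw far).
have UV := U_girth ((M + r).*2 + 10).
(* At radius 0 the only special case is [rho x = rho j], where there is no loop to count. At radius
   [r.+1], a vertex [rho j] within [r] makes the literal hold at all neighbours, and the exact
   distances [r.+1] and [r.+2] single out one neighbour. *)
case: r Ufar UV => [|r] Ufar UV.
  apply: local_eq (local_if (lW 1) (local_if (lW 0) l0 (lV 0)) l0) _.
  apply: ultra_mono2 Ufar UV _ => k far gN rho.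
  case: ifPn => [w1|/far //]; case: ifPn => w0.
    apply: big_pred0 => w; rewrite /nbr /literal /=; rewrite eqb_id; move: w0 => /= /eqP->.
    by case: eqVneq => [->|_]; rewrite ?andbF // e_irr.
  apply: (count_nbr_exact LM gN); rewrite /at_dist ?w1 ?w0 //; lia.
apply: local_eq (local_if (lW r.+2) (local_if (lW r) lL
  (local_if (lW r.+1) (lV r) (lV r.+1))) l0) _.
apply: ultra_mono2 Ufar UV _ => k far gN rho.
case: ifPn => [w2|/far //]; case: ifPn => w0.
  apply: eq_bigl => w; rewrite /nbr /=; case xw: (e k _ w) => //=.
  by rewrite /literal /= -[_ || _]/(within _ r.+1 _ _) (within_adj_near (@e_sym k) xw w0).
case: ifPn => w1; apply: (count_nbr_exact LM gN); rewrite /at_dist ?w2 ?w1 ?w0 //; lia.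
Qed.

(** * Counting over balls and over all vertices *)

Definition everywhere : vertex_range := fun _ _ _ => true.

(** Uniqueness of the predecessor makes the balls around the neighbours of [x] disjoint outside the
    ball of radius [r] around [x]. *)
Lemma sum_nbr_geodesic r N k (x v : T k) : girth_gt (e k) N -> (r.*2 + 2 < N)%N ->
    ~~ within (e k) r v x ->
  \sum_(w | e k x w && within (e k) r v w) 1 = (within (e k) r.+1 v x : nat)%:Z.
Proof.
move=> gN rN; rewrite !(within_sym (@e_sym k) _ v x) => xv.
have sym w : within (e k) r v w = within (e k) r w v by exact: within_sym.
case xv1: (within (e k) r.+1 x v); last first.
  apply: big_pred0 => w; apply/andP=> -[xw]; rewrite sym => wv.
  by move: (within_step xw wv); rewrite xv1.
have dxv : at_dist (e k) r.+1 x v by rewrite /at_dist xv1.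
have [w0 xw0 w0v] := at_dist_pred (@e_sym k) dxv.
rewrite (eq_bigl (pred1 w0)) ?big_pred1_eq // => w /=; rewrite sym.
have [->|ww0] := eqVneq w w0; first by rewrite xw0 (at_dist_within w0v) leqnn.
apply/andP=> -[xw wv]; case/eqP: ww0.
apply: (@pred_unique _ _ (@e_sym k) N gN r x _ _ v) => //; first by lia.
by rewrite -(@within_adj_exact _ _ (@e_sym k) (@e_irr k) N gN r r x) //; lia.
Qed.

(* The sphere of radius r+1 around x is the disjoint union, over the neighbours
   w of x, of the points at distance at most r from w that are farther from x. *)
Lemma local_count_ball r j L : local (@count_in everywhere ((r, j, true) :: L)).
Proof.
elim: r j L => [|r IH] j L.
  apply: local_ext (localb_all (B := fun l k rho =>
    within (e k) l.1.1 (rho j) (rho l.1.2) == l.2) L _) _ => [l|k rho].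
    exact/localb_eqb/localb_within.
  rewrite /count_in (eq_bigl (fun v => (v == rho j) && all (literal rho (rho j)) L)).
    rewrite -[RHS]/((all (literal rho (rho j)) L : nat)%:Z).
    case: (all _ L); last by rewrite big_pred0 // => v; rewrite andbF.
    by rewrite (eq_bigl (pred1 (rho j))) ?big_pred1_eq // => v; rewrite andbT.
  by move=> v; rewrite /literal /= eqb_id; case: eqVneq => // ->.
(* The fresh variable [z] names the neighbour [w], so updating it disturbs neither [j] nor [L]; the
   literal [(r, j, false)] keeps only points of the sphere. *)
have [z0 Lz] := seq_le_bound (fun l => l.1.2) L; pose z := (maxn z0 j).+1.
have lS := local_sum z (local_count_nbr j) (IH z ((r, j, false) :: L)) [::].
apply: local_eq (localD (IH j L) lS) _.
apply: ultra_mono (U_girth (r.*2 + 3)) _ => k gN rho.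
rewrite /count_in (bigID (fun v => within (e k) r v (rho j))) /=; congr (_ + _).
  apply: eq_bigl => v; rewrite /literal /= !eqb_id.
  by case: (within (e k) r v (rho j)); rewrite /= ?andbT ?andbF.
have updz w i : (i < z)%N -> upd rho z w i = rho i.
  by rewrite /upd; case: ltngtP.
transitivity (\sum_(w | nbr j rho w) \sum_(v | within (e k) r v w &&
    (~~ within (e k) r v (rho j) && all (literal rho v) L)) (1 : int)); last first.
  apply: eq_big => [w|w _]; first by rewrite andbT.
  apply: eq_bigl => v; rewrite /everywhere /literal /= {1}/upd eqxx eqb_id.
  rewrite updz ?eqbF_neg; last by rewrite /z; lia.
  congr (_ && (_ && _)); apply: eq_in_all => -[[s i] b] /Lz /= iz; rewrite /literal updz //=.
  by rewrite /z; lia.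
(* Summing over [w] first counts the neighbours through which [v] is reached. *)
rewrite (exchange_big_dep (fun v =>
  ~~ within (e k) r v (rho j) && all (literal rho v) L)) /=; last by move=> w v _ /andP[].
rewrite [RHS](eq_bigr (fun v => if within (e k) r.+1 v (rho j) then 1 else 0)).
  rewrite -big_mkcondr; apply: eq_bigl => v.
  by rewrite /everywhere /literal eqb_id /=; case: (all _ L); rewrite ?andbF ?andbT //= andbC.
move=> v /andP[vj vL]; under eq_bigl do rewrite vj vL !andbT.
by rewrite (sum_nbr_geodesic gN) //; [case: within|lia].
Qed.

Lemma local_count L : local (@count_in everywhere L).
Proof.
move: L; apply: local_count_in => [|r j L _]; last exact: local_count_ball.
apply: local_ext (local_const poly_ae_card) _ => k rho.
by rewrite /count_in -sum1_card -natz natr_sum.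
Qed.

Lemma local_sum_all i F : local F -> local (fun k rho => \sum_v F k (upd rho i v)).
Proof.
by move=> lF; apply: local_ext (local_sum i local_count lF [::]) _.
Qed.

(** * Quantifiers and formulas *)

Lemma localb_ex i B : localb B ->
  localb (fun k rho => [exists v, B k (upd rho i v)]).
Proof.
move=> /(local_sum_all i) /(localb_test (fun x => x != 0)) lB.
apply: localb_eq lB _ => k rho; under eq_bigr do rewrite -natz.
rewrite -natr_sum Num.Theory.pnatr_eq0 sum_nat_eq0 negb_forall.
by apply: eq_existsb => v; case: (B k _).
Qed.

Lemma localb_sat f : localb (fun k rho => sat (e k) rho f).
Proof.
elim: f => /=.
- exact: localb_const.
- exact: localb_const.
- by move=> i j; apply: (localb_within 0).
(* Adjacency is distance exactly 1. *)
- move=> i j; apply: localb_eq (localbI (localb_within 1 i j)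
    (localbN (localb_within 0 i j))) _ => k rho /=.
  have [->|ij] /= := eqVneq; first by rewrite e_irr.
  rewrite andbT; apply/idP/existsP => [ij'|[w /andP[iw /eqP <-] //]].
  by exists (rho j); rewrite ij' eqxx.
- by move=> f; apply: localbN.
- by move=> f lf g lg; apply: localbI.
- move=> f lf g lg; apply: localb_eq (localbN (localbI (localbN lf) (localbN lg))) _.
  by move=> k rho; rewrite negb_and !negbK.
- move=> f lf g lg; apply: localb_eq (localbN (localbI lf (localbN lg))) _.
  by move=> k rho; rewrite negb_and negbK implybE.
- by move=> i f; apply: localb_ex.
- move=> i f /localbN/(localb_ex i)/localbN lf; apply: localb_eq lf _ => k rho.
  by rewrite negb_exists; apply: eq_forallb => v; rewrite negbK.
Qed.

(** Along one chosen valuation per [k], each test becomes a sequence of truth values, which the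
    ultrafilter decides. *)
Lemma local_poly_ae F (s : forall k, option (nat -> T k)) : local F ->
  poly_ae (fun k => if s k is Some rho then F k rho else 0).
Proof.
elim=> {F} [g F pg UF|r i j F1 F2 F _ p1 _ p2 UF].
  pose b k := s k : bool.
  apply: poly_ae_eq (poly_aeM (poly_ae_bool b) pg) _.
  by apply: ultra_mono UF _ => k h; rewrite /b; case: (s k) => [rho|]; rewrite ?mul1r ?mul0r.
pose b k := if s k is Some rho then within (e k) r (rho i) (rho j) else false.
apply: poly_ae_eq (poly_aeD (poly_aeM (poly_ae_bool b) p1)
  (poly_aeM (poly_ae_bool (fun k => ~~ b k)) p2)) _.
apply: ultra_mono UF _ => k h; rewrite /b; case: (s k) => [rho|]; last by rewrite !mulr0 addr0.
by rewrite h; case: within; rewrite /= ?mul1r ?mul0r ?addr0 ?add0r.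
Qed.

End LocalFunctions.

(** * Cardinalities of definable sets *)

Lemma nonprincipal_eventually (U : (nat -> Prop) -> Prop) (A : nat -> Prop) K :
  ultrafilter U -> nonprincipal U -> (forall k, K <= k -> A k) -> U A.
Proof.
move=> [UT U0 Umono Uand Udec] Unp hA.
suff UK : U (fun k => K <= k) by apply: Umono UK hA.
elim: K {hA} => [|K IH]; first by apply: Umono UT _.
have [/Unp //|neK] := Udec (fun k => k = K).
by apply: Umono (Uand _ _ IH neK) _ => k [Kk /eqP kK]; rewrite ltn_neqAle eq_sym kK.
Qed.

Theorem theorem4p9
  (T : nat -> finType) (e : forall k, rel (T k)) (d : nat -> nat)
  (Hsimple : forall k, simple_graph (e k))
  (Hreg : forall k, regular (e k) (d k))
  (Hdeg : forall N, exists K, forall k, K <= k -> N <= d k)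
  (Hgirth : forall N, exists K, forall k, K <= k -> girth_gt (e k) N)
  (U : (nat -> Prop) -> Prop) (HU : ultrafilter U) (HUnp : nonprincipal U)
  (phi : formula) (m : nat) (Hphi : fv_below m.+1 phi)
  (a : forall k, 'I_m -> T k) :
  exists p : {mpoly int[2]},
    U (fun k => (#|defset (e k) phi (a k)|%:Z)%R =
                eval2 p (#|T k|%:Z)%R ((d k)%:Z)%R).
Proof.
have U_girth N : U (fun k => girth_gt (e k) N).
  by have [K hK] := Hgirth N; apply: nonprincipal_eventually hK.
have lphi := localb_sat Hsimple Hreg HU U_girth phi.
have lsum := local_sum_all Hsimple Hreg HU U_girth 0 lphi.
(* H_k may be empty, and then it has no valuation. *)
pose s k := omap (env (a k)) [pick x : T k].
apply: (poly_ae_eq HU (local_poly_ae HU s lsum)).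
apply: (ultra_all HU) => k; rewrite /s; case: pickP => [x0 _|T0] /=; last first.
  by rewrite (eq_card0 (fun x => _)) // => x; have := T0 x.
rewrite -sum1_card big_mkcond -natz GRing.natr_sum.
apply: eq_bigr => x _; rewrite inE.
(* The valuations differ only in the default value past the parameters, where [phi] has no free
   variable. *)
rewrite (@sat_eq_free _ _ _ _ (upd (env (a k) x0) 0 x)); first by case: sat.
case=> [|j] // /Hphi jm; rewrite /upd /=.
by case: insubP => //; rewrite -ltnS jm.
Qed.
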